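(* Let $\Gamma$ be a finite quiver with $\Gamma=\Gamma'\cup\Gamma''$, where $\Gamma'$ and $\Gamma''$ are nontrivial sub-quivers of $\Gamma$ and $\Gamma'\cap\Gamma''=\emptyset$, and let $(T,f)$ be a top-representation of $\Gamma$. Let $(T',f')$ be the restriction of $(T,f)$ to $\Gamma'$ (that is, $T'(i)=T(i)$ and $f'_a=f_a$ for vertices $i$ and arrows $a$ of $\Gamma'$), and similarly let $(T'',f'')$ be the restriction of $(T,f)$ to $\Gamma''$. Then there is a homeomorphism $$At^\Gamma(T,f)\simeq At^{\Gamma'}(T',f')\coprod At^{\Gamma''}(T'',f'').$$
   Context: A quiver $\Gamma=(\Gamma_0,\Gamma_1)$ is an oriented graph; it is finite if $\Gamma_0$ and $\Gamma_1$ are finite; a sub-quiver is an oriented sub-graph (nontrivial meaning nonempty). A top-representation $(T,f)$ of $\Gamma$ is a family of topological spaces $T(i)$, $i\in\Gamma_0$, with a continuous map $f_a:T(i)\to T(j)$ for each arrow $a:i\to j$. $At^\Gamma(T,f)$ is the quotient space of $\coprod_{i\in\Gamma_0}T(i)$ by the equivalence relation generated by $D=\{(x_i,x_j): x_i\in T(i),\ x_j\in T(j),\ f_a(x_i)=x_j\text{ for some arrow }a:i\to j\}$; similarly for $\Gamma'$ and $\Gamma''$. $\coprod$ denotes the disjoint union of topological spaces. *)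

(* Defs.v *)
From HB Require Import structures.
From Stdlib Require Export Relation_Operators.
From mathcomp Require Export all_boot generic_quotient.
From mathcomp Require Export boolp classical_sets functions cardinality topology.

Set Implicit Arguments.
Unset Strict Implicit.
Unset Printing Implicit Defensive.

Local Open Scope classical_set_scope.
Local Open Scope quotient_scope.

(** * Quivers *)

(* Vertices form a choiceType because the library topologizes {i : I & X i}
   only for I : choiceType; this is classically no restriction. *)
Record quiver := Quiver {
  vertex : choiceType;
  arrow : Type;
  source : arrow -> vertex;
  target : arrow -> vertex }.

Definition finite_quiver (G : quiver) : Prop :=
  finite_set [set: vertex G] /\ finite_set [set: arrow G].

Record subquiver (G : quiver) := Subquiver {
  subvertex : set (vertex G);
  subarrow : set (arrow G);
  subsource : forall a, subarrow a -> subvertex (source a);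
  subtarget : forall a, subarrow a -> subvertex (target a) }.

Section SubquiverOperations.
Context (G : quiver).
Implicit Types S : subquiver G.

Definition subquiver_full : subquiver G :=
  @Subquiver G setT setT (fun _ _ => I) (fun _ _ => I).

Definition subquiver_empty : subquiver G :=
  @Subquiver G set0 set0 (fun _ => id) (fun _ => id).

Program Definition subquiver_union S1 S2 : subquiver G :=
  @Subquiver G (subvertex S1 `|` subvertex S2) (subarrow S1 `|` subarrow S2) _ _.
Next Obligation. by move=> ? ? a [/subsource|/subsource]; [left|right]. Qed.
Next Obligation. by move=> ? ? a [/subtarget|/subtarget]; [left|right]. Qed.

Program Definition subquiver_inter S1 S2 : subquiver G :=
  @Subquiver G (subvertex S1 `&` subvertex S2) (subarrow S1 `&` subarrow S2) _ _.
Next Obligation. by move=> ? ? a [/subsource ? /subsource]. Qed.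
Next Obligation. by move=> ? ? a [/subtarget ? /subtarget]. Qed.

(* An arrow of S brings its endpoints along, so S is nonempty exactly when it
   has a vertex. *)
Definition subquiver_nontrivial S : Prop := subvertex S !=set0.

Definition quiver_of_subquiver S : quiver :=
  @Quiver (set_type (subvertex S)) (set_type (subarrow S))
    (fun a => exist _ (source (\val a)) (mem_set (subsource (set_valP a))))
    (fun a => exist _ (target (\val a)) (mem_set (subtarget (set_valP a)))).

End SubquiverOperations.

Coercion quiver_of_subquiver : subquiver >-> quiver.

(** * Top-representations *)

Record toprep (G : quiver) := Toprep {
  space :> vertex G -> topologicalType;
  rmap : forall a : arrow G, space (source a) -> space (target a);
  rmap_continuous : forall a, continuous (@rmap a) }.

Definition toprep_restrict (G : quiver) (T : toprep G) (S : subquiver G) :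
    toprep S :=
  @Toprep S (fun i => T (\val i)) (fun a => @rmap G T (\val a))
    (fun a => @rmap_continuous G T (\val a)).

(** * The space At *)

Section At.
Context (G : quiver) (T : toprep G).

Definition At_generator (x y : {i & T i}) : Prop :=
  exists (a : arrow G) (t : T (source a)),
    x = existT _ (source a) t /\ y = existT _ (target a) (rmap t).

Definition At_rel (x y : {i & T i}) : bool :=
  `[< clos_refl_sym_trans _ At_generator x y >].

Lemma At_rel_refl : reflexive At_rel.
Proof. by move=> x; apply/asboolP; exact: rst_refl. Qed.

Lemma At_rel_sym : symmetric At_rel.
Proof. by move=> x y; apply/asboolP/asboolP; exact: rst_sym. Qed.

Lemma At_rel_trans : transitive At_rel.
Proof.
by move=> y x z /asboolP xy /asboolP yz; apply/asboolP; exact: rst_trans xy yz.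
Qed.

Canonical At_equiv := EquivRel At_rel At_rel_refl At_rel_sym At_rel_trans.

Definition At : topologicalType := quotient_topology {eq_quot At_equiv}.

End At.

(** * Binary disjoint unions and homeomorphisms *)

Definition topsum (X Y : topologicalType) : topologicalType :=
  {b : bool & (if b then X else Y) : topologicalType}.

Definition homeomorphic (X Y : topologicalType) : Prop :=
  exists (f : X -> Y) (g : Y -> X),
    [/\ cancel f g, cancel g f, continuous f & continuous g].

(* Main.v *)
Require Import Defs.

(** A continuous map out of [At T] is the same thing as a continuous map out of
    the coproduct of the spaces [T i] that takes equal values at both ends of
    each generating pair [(t, f_a t)] ([At_lift]).  Both directions of the
    homeomorphism are obtained this way.

    From the sum of the two smaller spaces to [At T], the inclusion of the
    vertices of a sub-quiver induces a map on coproducts, which sends generating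
    pairs to generating pairs ([At_incl]).

    In the other direction, every vertex lies in exactly one of the two
    sub-quivers, so a point of [T i] can be sent to its class in the summand of
    the sub-quiver that contains [i] ([dispatch]).  This respects the
    generating pairs because every arrow also lies in one of the two
    sub-quivers, which then contains both of its ends: no identification joins
    the two sides.

    The two maps are mutually inverse because they are so on representatives,
    by [At_join_dispatch], [dispatch_incl1] and [dispatch_incl2]. *)

Set Implicit Arguments.
Unset Strict Implicit.
Unset Printing Implicit Defensive.

Local Open Scope classical_set_scope.
Local Open Scope quotient_scope.

(** * Universal property of At *)

Section AtUniversal.
Context (G : quiver) (T : toprep G).

Definition At_class (x : {i & T i}) : At T := \pi_({eq_quot (At_equiv T)}) x.

Lemma At_class_continuous : continuous At_class.
Proof. exact: pi_continuous. Qed.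

Lemma At_class_surj (z : At T) : exists x, At_class x = z.
Proof. by exists (repr (z : {eq_quot (At_equiv T)})); exact: reprK. Qed.

Lemma At_class_rmap (a : arrow G) (t : T (source a)) :
  At_class (existT _ (source a) t) = At_class (existT _ (target a) (rmap t)).
Proof. by apply/eqmodP/asboolP; apply: rst_step; exists a, t. Qed.

Definition arrow_invariant Z (f : {i & T i} -> Z) : Prop :=
  forall (a : arrow G) (t : T (source a)),
    f (existT _ (source a) t) = f (existT _ (target a) (rmap t)).

Definition At_lift Z (f : {i & T i} -> Z) (z : At T) : Z :=
  f (repr (z : {eq_quot (At_equiv T)})).

(** The kernel of [f] is an equivalence relation containing the generating
    pairs, hence contains the relation they generate. *)
Lemma At_lift_class Z (f : {i & T i} -> Z) :
  arrow_invariant f -> forall x, At_lift f (At_class x) = f x.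
Proof.
move=> f_inv x; rewrite /At_lift /At_class; set y := repr _.
have /eqmodP/asboolP : \pi_({eq_quot (At_equiv T)}) y = \pi x by exact: reprK.
by move: y => y; elim=> // [{}x {}y [a [t [-> ->]]]|u v w _ -> _ ->]; first exact: f_inv.
Qed.

Lemma At_lift_continuous (Z : topologicalType) (f : {i & T i} -> Z) :
  arrow_invariant f -> continuous f -> continuous (At_lift f).
Proof.
move=> f_inv f_cont; apply/quotient_continuous.
by rewrite (_ : _ \o _ = f)//; apply/funext => x; exact: At_lift_class.
Qed.

End AtUniversal.

(** * Maps induced by sub-quivers *)

Section Inclusion.
Context (G : quiver) (T : toprep G) (S : subquiver G).
Let TS := toprep_restrict T S.

Definition subquiver_incl (x : {i & TS i}) : {i & T i} :=
  existT (fun i => T i) (\val (projT1 x)) (projT2 x).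

Lemma subquiver_incl_continuous : continuous subquiver_incl.
Proof.
move=> [i t]; apply: (@sigT_continuous _ _ _ (fun i => existT (fun i => T i) (\val i))).
by move=> j; exact: existT_continuous.
Qed.

Lemma At_class_incl_invariant :
  arrow_invariant (fun x => At_class (subquiver_incl x)).
Proof. by move=> a t; exact: (@At_class_rmap _ T (\val a)). Qed.

Definition At_incl : At TS -> At T :=
  At_lift (fun x => At_class (subquiver_incl x)).

Lemma At_incl_class x : At_incl (At_class x) = At_class (subquiver_incl x).
Proof. exact: (At_lift_class At_class_incl_invariant). Qed.

Lemma At_incl_continuous : continuous At_incl.
Proof.
apply: At_lift_continuous; first exact: At_class_incl_invariant.
move=> x; apply: continuous_comp; first exact: subquiver_incl_continuous.
exact: At_class_continuous.
Qed.

End Inclusion.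

(** * Splitting along a disjoint cover by two sub-quivers *)

Section Splitting.
Context (G : quiver) (G1 G2 : subquiver G) (T : toprep G).
Hypothesis cover : subquiver_union G1 G2 = subquiver_full G.
Hypothesis disjoint : subquiver_inter G1 G2 = subquiver_empty G.
Let T1 := toprep_restrict T G1.
Let T2 := toprep_restrict T G2.
Let Z := topsum (At T1) (At T2).

Let inj1 (z : At T1) : Z :=
  existT (fun b : bool => (if b then At T1 else At T2) : topologicalType) true z.
Let inj2 (z : At T2) : Z :=
  existT (fun b : bool => (if b then At T1 else At T2) : topologicalType) false z.

Lemma vertex_cover i : i \notin subvertex G1 -> i \in subvertex G2.
Proof.
move=> /negP i1; apply/mem_set.
have : subvertex (subquiver_full G) i by [].
by rewrite -cover => -[/mem_set|].
Qed.

Lemma vertex_disjoint i :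
  i \in subvertex G1 -> i \in subvertex G2 -> False.
Proof.
move=> /set_mem i1 /set_mem i2.
suff : subvertex (subquiver_empty G) i by [].
by rewrite -disjoint.
Qed.

Lemma arrow_cover a : subarrow G1 a \/ subarrow G2 a.
Proof.
have : subarrow (subquiver_full G) a by [].
by rewrite -cover.
Qed.

(** The membership proof is part of the data, since it is needed to form the
    corresponding vertex of the sub-quiver. *)
Definition vertex_side i : (i \in subvertex G1) + (i \in subvertex G2) :=
  match boolP (i \in subvertex G1) with
  | AltTrue i1 => inl i1
  | AltFalse i1 => inr (vertex_cover i1)
  end.

Lemma vertex_side1 i (i1 : i \in subvertex G1) : vertex_side i = inl i1.
Proof.
case: (vertex_side i) => [h|/(vertex_disjoint i1)//].
by congr inl; exact: bool_irrelevance.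
Qed.

Lemma vertex_side2 i (i2 : i \in subvertex G2) : vertex_side i = inr i2.
Proof.
case: (vertex_side i) => [/vertex_disjoint/(_ i2)//|h].
by congr inr; exact: bool_irrelevance.
Qed.

Definition dispatch_at i (t : T i) : Z :=
  match vertex_side i with
  | inl i1 => inj1 (At_class (existT (fun i => T1 i) (exist _ i i1) t))
  | inr i2 => inj2 (At_class (existT (fun i => T2 i) (exist _ i i2) t))
  end.

Definition dispatch : {i & T i} -> Z :=
  fun x => dispatch_at (projT2 x).

Lemma dispatch_incl1 (x : {i & T1 i}) :
  dispatch (subquiver_incl x) = inj1 (At_class x).
Proof.
by case: x => -[i i1] t; rewrite /dispatch/= /dispatch_at /= (vertex_side1 i1).
Qed.

Lemma dispatch_incl2 (x : {i & T2 i}) :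
  dispatch (subquiver_incl x) = inj2 (At_class x).
Proof.
by case: x => -[i i2] t; rewrite /dispatch/= /dispatch_at /= (vertex_side2 i2).
Qed.

Lemma dispatch_continuous : continuous dispatch.
Proof.
apply: (@sigT_continuous _ _ _ dispatch_at) => i; rewrite /dispatch_at.
case: (vertex_side i) => h t.
- apply: (@continuous_comp _ _ _ (fun t => At_class (existT (fun i => T1 i) (exist _ i h) t))
    inj1); last exact: existT_continuous.
  apply: (@continuous_comp _ _ _ (existT (fun i => T1 i) (exist _ i h))).
    exact: existT_continuous.
  exact: At_class_continuous.
- apply: (@continuous_comp _ _ _ (fun t => At_class (existT (fun i => T2 i) (exist _ i h) t))
    inj2); last exact: existT_continuous.
  apply: (@continuous_comp _ _ _ (existT (fun i => T2 i) (exist _ i h))).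
    exact: existT_continuous.
  exact: At_class_continuous.
Qed.

(** An arrow of one of the sub-quivers has both ends there, so the two points
    are sent to the same summand, where they are already identified. *)
Lemma dispatch_invariant : arrow_invariant dispatch.
Proof.
move=> a t; have [/mem_set a1|/mem_set a2] := arrow_cover a.
- pose b : arrow G1 := exist _ a a1.
  have /= := congr1 inj1 (@At_class_rmap _ T1 b t).
  by rewrite -!dispatch_incl1.
- pose b : arrow G2 := exist _ a a2.
  have /= := congr1 inj2 (@At_class_rmap _ T2 b t).
  by rewrite -!dispatch_incl2.
Qed.

Definition At_split : At T -> Z := At_lift dispatch.

Definition At_join_summand (b : bool) :
    ((if b then At T1 else At T2) : topologicalType) -> At T :=
  match b with
  | true => @At_incl G T G1
  | false => @At_incl G T G2
  end.

Definition At_join : Z -> At T :=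
  fun z => At_join_summand (projT2 z).

Lemma At_split_continuous : continuous At_split.
Proof.
exact: At_lift_continuous dispatch_invariant dispatch_continuous.
Qed.

Lemma At_join_continuous : continuous At_join.
Proof. by apply: (@sigT_continuous _ _ _ At_join_summand) => -[]; exact: At_incl_continuous. Qed.

Lemma At_join_dispatch x : At_join (dispatch x) = At_class x.
Proof.
case: x => i t; rewrite /dispatch/= /dispatch_at.
by case: (vertex_side i) => h; rewrite /At_join/= At_incl_class.
Qed.

Lemma At_splitK : cancel At_split At_join.
Proof.
move=> z; have [x <-] := At_class_surj z.
by rewrite /At_split (At_lift_class dispatch_invariant) At_join_dispatch.
Qed.

Lemma At_joinK : cancel At_join At_split.
Proof.
move=> -[[] z]; have [x <-] := At_class_surj z; rewrite /At_join/= At_incl_class.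
- by rewrite /At_split (At_lift_class dispatch_invariant) dispatch_incl1.
- by rewrite /At_split (At_lift_class dispatch_invariant) dispatch_incl2.
Qed.

End Splitting.

Theorem theorem6p6 (G : quiver) (G1 G2 : subquiver G) (T : toprep G) :
  finite_quiver G ->
  subquiver_union G1 G2 = subquiver_full G ->
  subquiver_nontrivial G1 ->
  subquiver_nontrivial G2 ->
  subquiver_inter G1 G2 = subquiver_empty G ->
  homeomorphic (At T)
    (topsum (At (toprep_restrict T G1)) (At (toprep_restrict T G2))).
Proof.
move=> _ cover _ _ disjoint.
exists (At_split cover), (@At_join G G1 G2 T); split.
- exact: At_splitK.
- exact: At_joinK.
- exact: At_split_continuous.
- exact: At_join_continuous.
Qed.
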